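(* Let $n=1$. There exists $\bar\varepsilon>0$ such that the following holds for every $\varepsilon_0\in(0,\bar\varepsilon)$. Let $V_1,V_2\in C(\mathbb{T})$ satisfy: (a) $\{V_1=0\}=[\tfrac{4}{16},\tfrac{12}{16}]$, $\{V_1=-\varepsilon_0\}=[0,1]\setminus(\tfrac{3}{16},\tfrac{13}{16})$, and $-\varepsilon_0\le V_1\le0$ on $\mathbb{T}$; (b) $\{V_2=0\}=[\tfrac{7}{16},\tfrac{9}{16}]$, $\{V_2=2\}=[0,1]\setminus(\tfrac{6}{16},\tfrac{10}{16})$, and $0\le V_2\le2$ on $\mathbb{T}$. Let $H_i(\xi,p)=|p|^2-V_i(\xi)$ for $i=1,2$. Then there exists $\gamma>0$ such that $\overline{H}(P)=0$ for all $P\in\mathbb{R}$ with $|P|\le\gamma$.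
   Context: $\mathbb{T}=\mathbb{R}/\mathbb{Z}$ is identified with $[0,1]$ (endpoints glued), and functions on $\mathbb{T}$ are identified with $1$-periodic functions on $\mathbb{R}$. Effective Hamiltonian: for each $P\in\mathbb{R}$ it is known that there is a unique constant $\overline{H}(P)$ such that the cell problem $$H_1(\xi,P+Dv_1(\xi))+v_1(\xi)-v_2(\xi)=\overline{H}(P),\qquad H_2(\xi,P+Dv_2(\xi))+v_2(\xi)-v_1(\xi)=\overline{H}(P)\quad\text{in }\mathbb{T}$$ admits a continuous viscosity solution $(v_1,v_2)\in C(\mathbb{T})^2$ (viscosity inequalities are imposed on each component with the other component inserted as a given function). *)

(* Defs.v *)
From Stdlib Require Import Reals.
From Coquelicot Require Import Coquelicot.

Open Scope R_scope.

(** Functions on the torus R/Z are represented by their 1-periodic lifts to R. *)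
Definition continuous_on_torus (f : R -> R) : Prop :=
  (forall x : R, continuous f x) /\ (forall x : R, f (x + 1) = f x).

Definition C1 (phi : R -> R) : Prop :=
  forall x : R, ex_derive phi x /\ continuous (Derive phi) x.

(** Viscosity sub- and supersolutions of a scalar first-order equation
    [F x (u x) (u' x) = 0].  Touching is local, so for a 1-periodic [u] it makes
    no difference whether the test functions are periodic. *)
Definition viscosity_subsolution (F : R -> R -> R -> R) (u : R -> R) : Prop :=
  forall (phi : R -> R) (x : R), C1 phi ->
    locally x (fun y => u y - phi y <= u x - phi x) ->
    F x (u x) (Derive phi x) <= 0.

Definition viscosity_supersolution (F : R -> R -> R -> R) (u : R -> R) : Prop :=
  forall (phi : R -> R) (x : R), C1 phi ->
    locally x (fun y => u x - phi x <= u y - phi y) ->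
    0 <= F x (u x) (Derive phi x).

Definition viscosity_solution (F : R -> R -> R -> R) (u : R -> R) : Prop :=
  viscosity_subsolution F u /\ viscosity_supersolution F u.

(** In each equation only the differentiated component is the unknown; the other
    one enters as a given function of the space variable. *)
Definition cell_problem_solution
    (H1 H2 : R -> R -> R) (P c : R) (v1 v2 : R -> R) : Prop :=
  continuous_on_torus v1 /\ continuous_on_torus v2 /\
  viscosity_solution (fun xi r p => H1 xi (P + p) + r - v2 xi - c) v1 /\
  viscosity_solution (fun xi r p => H2 xi (P + p) + r - v1 xi - c) v2.

(** [is_effective_hamiltonian H1 H2 P c] reads "the effective Hamiltonian at [P]
    is [c]": [c] is the unique constant for which the cell problem is solvable. *)
Definition is_effective_hamiltonian (H1 H2 : R -> R -> R) (P c : R) : Prop :=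
  unique (fun a : R =>
    exists v1 v2 : R -> R, cell_problem_solution H1 H2 P a v1 v2) c.

Definition potential_hamiltonian (V : R -> R) (xi p : R) : R :=
  Rabs p ^ 2 - V xi.

(* Main.v *)
(** The constant is pinned to [0] from both sides.  The terms [v1 - v2] cancel in the sum of
    the two equations, so a subsolution forces [0 <= V1 + V2 + 2 c] pointwise, and both
    potentials vanish at [1/2].  Conversely, for small [P] there is a [C1] subsolution with
    [c = 0]; touching a solution with constant [c] from below by it gives [c <= 0].  Its
    difference of components [- q^2 / 1000] dips below [- eps0] wherever [V1 < 0], which is
    possible as long as [V2] is large there and [eps0] is small, and its second component has
    slope proportional to [P q], where [q] is supported away from [1/2].
    A solution with [c = 0] comes from Perron's method, as the upper envelope of the Lipschitz
    subsolutions vanishing at the points [k + 1/2]: at such a point the supersolution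
    inequality is automatic, because the envelope and both potentials vanish there. *)

From Stdlib Require Import Reals ZArith Lra Lia Classical.
From Coquelicot Require Import Coquelicot.
Require Import Defs.
Open Scope R_scope.

(** The two components are indexed by [bool]; [negb i] is the index of the other one. *)
Definition weakly_coupled (V : bool -> R -> R) (P c : R) (u : bool -> R -> R) (i : bool)
    (x r p : R) : R :=
  potential_hamiltonian (V i) x (P + p) + r - u (negb i) x - c.

Definition coupled_subsolution (V : bool -> R -> R) (P c : R) (u : bool -> R -> R) : Prop :=
  forall i, viscosity_subsolution (weakly_coupled V P c u i) (u i).

Definition coupled_supersolution (V : bool -> R -> R) (P c : R) (u : bool -> R -> R) : Prop :=
  forall i, viscosity_supersolution (weakly_coupled V P c u i) (u i).

(** * Neighbourhoods, touching, and test functions *)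

Lemma locally_Rabs (x : R) (Q : R -> Prop) :
  locally x Q -> exists r, 0 < r /\ forall y, Rabs (y - x) < r -> Q y.
Proof. intros [e He]. exists e. split. apply cond_pos. exact He. Qed.

Lemma Rabs_locally (x r : R) (Q : R -> Prop) :
  0 < r -> (forall y, Rabs (y - x) < r -> Q y) -> locally x Q.
Proof. intros Hr H. exists (mkposreal r Hr). exact H. Qed.

Lemma continuous_locally_lt (f : R -> R) (x c : R) :
  continuous f x -> f x < c -> locally x (fun y => f y < c).
Proof. intros Hf Hlt. apply (Hf (fun z => z < c)). apply (open_lt c (f x) Hlt). Qed.

Lemma lipschitz_continuous (f : R -> R) (K : R) :
  (forall x y, Rabs (f x - f y) <= K * Rabs (x - y)) -> forall x, continuous f x.
Proof.
intros Hf x. apply continuity_pt_filterlim. intros e He.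
exists (e / (Rabs K + 1)). pose proof (Rabs_pos K). split.
- apply Rdiv_lt_0_compat; lra.
- intros y [_ Hy]. simpl in *. unfold R_dist in *.
  apply Rle_lt_trans with (1 := Hf y x).
  apply Rle_lt_trans with (Rabs K * Rabs (y - x)).
  + apply Rmult_le_compat_r. apply Rabs_pos. apply Rle_abs.
  + apply Rle_lt_trans with ((Rabs K + 1) * Rabs (y - x)).
    * pose proof (Rabs_pos (y - x)). nra.
    * apply Rmult_lt_reg_r with (/ (Rabs K + 1)). apply Rinv_0_lt_compat; lra.
      replace ((Rabs K + 1) * Rabs (y - x) * / (Rabs K + 1)) with (Rabs (y - x)) by (field; lra).
      exact Hy.
Qed.

(** A maximum over the closed interval exists by compactness, and the two strict inequalities keep
    it off the endpoints, so it is a local maximum on the line. *)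
Lemma interior_max (g : R -> R) (x r : R) :
  0 < r -> (forall y, continuous g y) -> g (x - r) < g x -> g (x + r) < g x ->
  exists y, Rabs (y - x) < r /\ g x <= g y /\ locally y (fun z => g z <= g y).
Proof.
intros Hr Hg Hl Hu.
destruct (continuity_ab_maj g (x - r) (x + r)) as [y [Hmax Hy]].
- lra.
- intros c _. apply continuity_pt_filterlim. apply Hg.
- assert (Hxy : g x <= g y) by (apply Hmax; lra).
  assert (y <> x - r) by (intros ->; lra).
  assert (y <> x + r) by (intros ->; lra).
  exists y. repeat split; auto.
  + apply Rabs_def1; lra.
  + apply (Rabs_locally y (Rmin (y - (x - r)) (x + r - y))).
    * apply Rmin_pos; lra.
    * intros z Hz. apply Hmax.
      pose proof (Rmin_l (y - (x - r)) (x + r - y)). pose proof (Rmin_r (y - (x - r)) (x + r - y)).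
      apply Rabs_def2 in Hz. lra.
Qed.

Lemma Derive_eq_of_touching (f g : R -> R) (x : R) :
  ex_derive f x -> ex_derive g x ->
  locally x (fun y => f y - g y <= f x - g x) -> Derive f x = Derive g x.
Proof.
intros Hf Hg Hloc. apply locally_Rabs in Hloc. destruct Hloc as [r [Hr H]].
assert (Hd : is_derive (fun y => f y - g y) x (Derive f x - Derive g x)).
{ apply (is_derive_minus f g); apply Derive_correct; assumption. }
apply is_derive_Reals in Hd.
pose (pr := exist _ _ Hd : derivable_pt (fun y => f y - g y) x).
assert (E : derive_pt _ _ pr = 0).
{ apply (deriv_maximum _ (x - r) (x + r)); try lra.
  intros y H1 H2. apply H. apply Rabs_def1; lra. }
simpl in E. lra.
Qed.

Lemma C1_continuous (f : R -> R) (x : R) : C1 f -> continuous f x.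
Proof. intros Hf. apply (@ex_derive_continuous _ R_NormedModule). apply Hf. Qed.

Lemma is_derive_C1 (f g : R -> R) :
  (forall x, is_derive f x (g x)) -> (forall x, continuous g x) -> C1 f.
Proof.
intros Hd Hc x. split.
- exists (g x). apply Hd.
- apply continuous_ext with g. intros y. symmetry. apply is_derive_unique, Hd. apply Hc.
Qed.

(** The coefficient [k] and both constants stay free, so that one formula serves the steep parabola
    of [subsolution_gap], the strict maximum ([k = 1]) and the bump ([k = -1]) of Perron's
    method. *)
Lemma is_derive_add_parabola (f : R -> R) (a k x c y : R) :
  ex_derive f y ->
  is_derive (fun z => a + f z + k * (z - x) ^ 2 + c) y (Derive f y + 2 * k * (y - x)).
Proof.
intros Hf. auto_derive. exact Hf. ring_simplify.
change (fun x => f x) with f. ring.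
Qed.

Lemma C1_add_parabola (f : R -> R) (a k x c : R) :
  C1 f -> C1 (fun z => a + f z + k * (z - x) ^ 2 + c).
Proof.
intros Hf. apply is_derive_C1 with (fun y => Derive f y + 2 * k * (y - x)).
- intros y. apply is_derive_add_parabola, Hf.
- intros y. apply (continuous_plus (Derive f)). apply Hf.
  apply (@ex_derive_continuous _ R_NormedModule). auto_derive. trivial.
Qed.

Lemma continuous_weakly_coupled (V : bool -> R -> R) (P c : R) (u : bool -> R -> R) (i : bool)
    (r p : R -> R) (x : R) :
  continuous (V i) x -> continuous (u (negb i)) x -> continuous r x -> continuous p x ->
  continuous (fun y => weakly_coupled V P c u i y (r y) (p y)) x.
Proof.
intros HV Hu Hr Hp. unfold weakly_coupled, potential_hamiltonian.
apply (continuous_minus (V := R_NormedModule)); [|apply continuous_const].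
apply (continuous_minus (V := R_NormedModule)); [|exact Hu].
apply (continuous_plus (V := R_NormedModule)); [|exact Hr].
apply (continuous_minus (V := R_NormedModule)); [|exact HV].
apply continuous_ext with (fun y => (P + p y) * (P + p y)).
- intros y. symmetry. etransitivity. apply pow2_abs. simpl. ring.
- apply (continuous_mult (K := R_AbsRing));
  apply (continuous_plus (V := R_NormedModule)); auto; apply continuous_const.
Qed.

(** * Bounds on the constant of the cell problem *)

Lemma subsolution_gap (V : bool -> R -> R) (P c : R) (u : bool -> R -> R) (i : bool) (x : R) :
  (forall y, continuous (V i) y) -> (forall k y, continuous (u k) y) ->
  coupled_subsolution V P c u -> u i x - u (negb i) x <= V i x + c.
Proof.
intros HV Hu Hsub. apply Rnot_lt_le. intros Hlt.
(* Taking both [P] and the slope to be 0 leaves the operator without its square. *)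
pose (G := fun y => weakly_coupled V 0 c u i y (u i y) 0).
assert (HG : continuous (fun y => - G y) x).
{ apply (continuous_opp (V := R_NormedModule)), continuous_weakly_coupled; auto.
  apply continuous_const. }
assert (HG0 : - G x < 0).
{ unfold G, weakly_coupled, potential_hamiltonian. rewrite pow2_abs. lra. }
destruct (locally_Rabs _ _ (continuous_locally_lt _ _ _ HG HG0)) as [r' [Hr' Hpos]].
pose (r := r' / 2). assert (Hr : 0 < r) by (unfold r; lra).
(* At distance [r] the parabola exceeds the growth of [u i] by at least 1, so the maximum of the
   difference lies inside. *)
pose (C := (Rabs (u i (x - r) - u i x) + Rabs (u i (x + r) - u i x) + 1) / r ^ 2).
assert (HC : C * r ^ 2 = Rabs (u i (x - r) - u i x) + Rabs (u i (x + r) - u i x) + 1).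
{ unfold C. field. lra. }
pose (psi := fun z => 0 + (fun _ : R => 0) z + C * (z - x) ^ 2 + 0).
assert (Hpsi : C1 psi).
{ apply (C1_add_parabola (fun _ => 0)). apply is_derive_C1 with (fun _ => 0).
  intros. apply (@is_derive_const R_AbsRing R_NormedModule). intros; apply continuous_const. }
pose proof (Rle_abs (u i (x - r) - u i x)). pose proof (Rle_abs (u i (x + r) - u i x)).
pose proof (Rabs_pos (u i (x - r) - u i x)). pose proof (Rabs_pos (u i (x + r) - u i x)).
destruct (interior_max (fun y => u i y - psi y) x r) as [y [Hy [_ Hmax]]]; auto.
- intros y. apply (continuous_minus (V := R_NormedModule)); auto. apply C1_continuous, Hpsi.
- unfold psi. replace (x - r - x) with (- r) by ring. nra.
- unfold psi. replace (x + r - x) with r by ring. nra.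
- specialize (Hsub i psi y Hpsi Hmax).
  specialize (Hpos y ltac:(unfold r in Hy; lra)).
  unfold G, weakly_coupled, potential_hamiltonian in *. rewrite pow2_abs in *.
  pose proof (pow2_ge_0 (P + Derive psi y)). lra.
Qed.

Lemma classical_subsolution (V : bool -> R -> R) (P c : R) (u : bool -> R -> R) :
  (forall i, C1 (u i)) ->
  (forall i x, weakly_coupled V P c u i x (u i x) (Derive (u i) x) <= 0) ->
  coupled_subsolution V P c u.
Proof.
intros HC H i phi x Hphi Hloc.
rewrite <- (Derive_eq_of_touching (u i) phi x); auto. apply HC. apply Hphi.
Qed.

Lemma periodic_shift_IZR (f : R -> R) (n : Z) (x : R) :
  (forall y, f (y + 1) = f y) -> f (x + IZR n) = f x.
Proof.
intros Hf. revert x.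
assert (Hnat : forall (m : nat) x, f (x + INR m) = f x).
{ induction m as [|m IH]; intros x.
  - simpl. f_equal. ring.
  - rewrite S_INR, <- Rplus_assoc, Hf. apply IH. }
intros x. destruct (Z_le_gt_dec 0 n) as [Hn|Hn].
- rewrite <- (Z2Nat.id n) by lia. rewrite <- INR_IZR_INZ. apply Hnat.
- rewrite <- (Hnat (Z.to_nat (- n)) (x + IZR n)). f_equal.
  rewrite INR_IZR_INZ, Z2Nat.id, opp_IZR by lia. ring.
Qed.

Lemma exists_frac (x : R) : exists n : Z, 0 <= x + IZR n <= 1.
Proof.
exists (- (up x - 1))%Z. rewrite opp_IZR, minus_IZR. destruct (archimed x). lra.
Qed.

Lemma periodic_max (f : R -> R) :
  (forall x, continuous f x) -> (forall x, f (x + 1) = f x) ->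
  exists x, forall y, f y <= f x.
Proof.
intros Hc Hp. destruct (continuity_ab_maj f 0 1) as [x [Hx _]].
- lra.
- intros y _. apply continuity_pt_filterlim, Hc.
- exists x. intros y. destruct (exists_frac y) as [n Hn].
  rewrite <- (periodic_shift_IZR f n y Hp). apply Hx, Hn.
Qed.

(** Maximise [phi k y - w k y] over the index and the point together. At a maximum, [phi i] is a
    test function for [w i] from below, and maximality against the other index makes the coupling
    term of [phi] at least that of [w]. The two inequalities then differ only in their constants. *)
Lemma constant_le_of_classical_subsolution
    (V : bool -> R -> R) (P a c : R) (phi w : bool -> R -> R) :
  (forall i, C1 (phi i)) -> (forall i x, phi i (x + 1) = phi i x) ->
  (forall i x, weakly_coupled V P a phi i x (phi i x) (Derive (phi i) x) <= 0) ->
  (forall i, continuous_on_torus (w i)) -> coupled_supersolution V P c w -> c <= a.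
Proof.
intros HC Hp Hsub Hw Hsup.
assert (Hmax : forall i, exists x, forall y, phi i y - w i y <= phi i x - w i x).
{ intros i. apply (periodic_max (fun y => phi i y - w i y)).
  - intros x. apply (continuous_minus (V := R_NormedModule)). apply C1_continuous, HC. apply Hw.
  - intros x. rewrite Hp, (proj2 (Hw i)). reflexivity. }
assert (Hglob : exists i x, forall k y, phi k y - w k y <= phi i x - w i x).
{ destruct (Hmax true) as [x Hx], (Hmax false) as [y Hy].
  destruct (Rle_dec (phi true x - w true x) (phi false y - w false y)).
  - exists false, y. intros [] z; [specialize (Hx z)|specialize (Hy z)]; lra.
  - exists true, x. intros [] z; [specialize (Hx z)|specialize (Hy z)]; lra. }
destruct Hglob as [i [x Hx]].
assert (H : 0 <= weakly_coupled V P c w i x (w i x) (Derive (phi i) x)).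
{ apply (Hsup i (phi i) x (HC i)). apply filter_forall. intros y. specialize (Hx i y). lra. }
specialize (Hsub i x). specialize (Hx (negb i) x).
unfold weakly_coupled in *. lra.
Qed.

(** * Translations, and the lifts of the point 1/2 *)

Lemma C1_shift (f : R -> R) (s : R) : C1 f ->
  C1 (fun y => f (y - s)) /\ forall y, Derive (fun y => f (y - s)) y = Derive f (y - s).
Proof.
intros Hf.
assert (Hd : forall y, is_derive (fun y => f (y - s)) y (Derive f (y - s))).
{ intros y. auto_derive. apply Hf. rewrite Rmult_1_l. reflexivity. }
split.
- apply is_derive_C1 with (1 := Hd). intros y.
  apply (continuous_comp (fun y => y - s) (Derive f)); [|apply Hf].
  apply (@ex_derive_continuous _ R_NormedModule). auto_derive. trivial.
- intros y. apply is_derive_unique, Hd.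
Qed.

Lemma coupled_subsolution_shift (V : bool -> R -> R) (P c : R) (u : bool -> R -> R) (s : R) :
  (forall i x, V i (x + s) = V i x) -> coupled_subsolution V P c u ->
  coupled_subsolution V P c (fun i x => u i (x + s)).
Proof.
intros HV Hu i phi x Hphi Hloc.
destruct (C1_shift phi s Hphi) as [HC HD].
specialize (Hu i _ (x + s) HC).
rewrite HD in Hu. replace (x + s - s) with x in Hu by ring.
unfold weakly_coupled, potential_hamiltonian in *. rewrite HV in Hu. apply Hu.
apply locally_Rabs in Hloc. destruct Hloc as [r [Hr H]].
apply (Rabs_locally _ r); auto. intros y Hy.
specialize (H (y - s)). replace (y - s + s) with y in H by ring. apply H.
replace (y - s - x) with (y - (x + s)) by ring. exact Hy.
Qed.

(** The lifts of the point 1/2 of the torus, where both potentials vanish. *)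
Definition pin (x : R) : Prop := exists k : Z, x = IZR k + / 2.

Lemma pin_near (x : R) : exists z, pin z /\ Rabs (x - z) <= 1.
Proof.
destruct (exists_frac x) as [n Hn]. exists (IZR (- n) + / 2). split.
- exists (- n)%Z. reflexivity.
- rewrite opp_IZR. apply Rabs_le. lra.
Qed.

Lemma pin_shift (x : R) (n : Z) : pin x -> pin (x + IZR n).
Proof. intros [k ->]. exists (k + n)%Z. rewrite plus_IZR. ring. Qed.

Lemma locally_not_pin (x : R) : ~ pin x -> locally x (fun y => ~ pin y).
Proof.
(* [archimed] puts [x - / 2] in [[m - 1, m)]; as [x] is not a pin, it lies strictly between two
   consecutive pins. *)
intros Hx. destruct (archimed (x - / 2)) as [H1 H2]. set (m := up (x - / 2)) in *.
assert (x <> IZR (m - 1) + / 2) by (intros E; apply Hx; eexists; exact E).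
rewrite minus_IZR in *.
apply (Rabs_locally x (Rmin (IZR m + / 2 - x) (x - (IZR m - 1 + / 2)))).
- apply Rmin_pos; lra.
- intros y Hy [k ->].
  pose proof (Rmin_l (IZR m + / 2 - x) (x - (IZR m - 1 + / 2))).
  pose proof (Rmin_r (IZR m + / 2 - x) (x - (IZR m - 1 + / 2))).
  apply Rabs_def2 in Hy.
  assert (k < m)%Z by (apply lt_IZR; lra).
  assert (m - 1 < k)%Z by (apply lt_IZR; rewrite minus_IZR; lra). lia.
Qed.

(** * Admissible pairs and their upper envelope *)

(** The Lipschitz constant [6] is propagated by the bump construction: functions vanishing on
    [pin] are then bounded by [6], so the equation bounds slopes by [1 + sqrt (2 + 12) < 6]. *)
Record admissible (V : bool -> R -> R) (P : R) (u : bool -> R -> R) : Prop := {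
  admissible_lipschitz : forall i x y, Rabs (u i x - u i y) <= 6 * Rabs (x - y);
  admissible_pin : forall i z, pin z -> u i z = 0;
  admissible_subsolution : coupled_subsolution V P 0 u }.

Lemma admissible_continuous (V : bool -> R -> R) (P : R) (u : bool -> R -> R) :
  admissible V P u -> forall i x, continuous (u i) x.
Proof. intros Hu i. apply (lipschitz_continuous _ 6), Hu. Qed.

Lemma admissible_bound (V : bool -> R -> R) (P : R) (u : bool -> R -> R) (i : bool) (x : R) :
  admissible V P u -> Rabs (u i x) <= 6.
Proof.
intros Hu. destruct (pin_near x) as [z [Hz Hxz]].
pose proof (admissible_lipschitz _ _ _ Hu i x z) as H.
rewrite (admissible_pin _ _ _ Hu i z Hz), Rminus_0_r in H. lra.
Qed.

(** The supremum is taken separately for each component and each point. [real] sends an infinite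
    bound to 0; the lemmas below therefore take an admissible pair [phi], which makes the set
    nonempty. *)
Definition envelope (V : bool -> R -> R) (P : R) (i : bool) (x : R) : R :=
  real (Lub_Rbar (fun t => exists u, admissible V P u /\ u i x = t)).

(** The uniform bound 6 excludes plus infinity, and the value of [phi] excludes minus infinity. *)
Lemma envelope_lub (V : bool -> R -> R) (P : R) (phi : bool -> R -> R) (i : bool) (x : R) :
  admissible V P phi ->
  is_lub (fun t => exists u, admissible V P u /\ u i x = t) (envelope V P i x).
Proof.
intros Hphi. unfold envelope.
destruct (Lub_Rbar_correct (fun t => exists u, admissible V P u /\ u i x = t)) as [Hub Hleast].
destruct (Lub_Rbar _) as [l| |]; simpl.
- split.
  + intros t Ht. exact (Hub t Ht).
  + intros b Hb. apply (Hleast (Finite b)). intros t Ht. exact (Hb t Ht).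
- exfalso. apply (Hleast (Finite 6)). intros t [u [Hu <-]]. simpl.
  apply Rle_trans with (1 := Rle_abs _). apply (admissible_bound _ _ _ _ _ Hu).
- exfalso. apply (Hub (phi i x)). exists phi. auto.
Qed.

Lemma envelope_ge (V : bool -> R -> R) (P : R) (u : bool -> R -> R) (i : bool) (x : R) :
  admissible V P u -> u i x <= envelope V P i x.
Proof. intros Hu. apply (envelope_lub V P u i x Hu). exists u. auto. Qed.

Lemma envelope_le (V : bool -> R -> R) (P : R) (phi : bool -> R -> R) (i : bool) (x b : R) :
  admissible V P phi -> (forall u, admissible V P u -> u i x <= b) -> envelope V P i x <= b.
Proof.
intros Hphi Hb. apply (envelope_lub V P phi i x Hphi). intros t [u [Hu <-]]. auto.
Qed.

Lemma envelope_approx (V : bool -> R -> R) (P : R) (phi : bool -> R -> R) (i : bool) (x b : R) :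
  admissible V P phi -> b < envelope V P i x -> exists u, admissible V P u /\ b < u i x.
Proof.
intros Hphi Hb. apply NNPP. intros Hn. apply (Rlt_not_le _ _ Hb).
apply (envelope_le _ _ phi); auto. intros u Hu. apply Rnot_lt_le. intros Hlt.
apply Hn. exists u. auto.
Qed.

Lemma envelope_lipschitz (V : bool -> R -> R) (P : R) (phi : bool -> R -> R) (i : bool) (x y : R) :
  admissible V P phi -> Rabs (envelope V P i x - envelope V P i y) <= 6 * Rabs (x - y).
Proof.
intros Hphi.
assert (H : forall x y, envelope V P i x - envelope V P i y <= 6 * Rabs (x - y)).
{ clear x y. intros x y.
  assert (envelope V P i x <= envelope V P i y + 6 * Rabs (x - y)); [|lra].
  apply (envelope_le _ _ phi); auto. intros u Hu.
  pose proof (envelope_ge _ _ _ i y Hu).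
  pose proof (admissible_lipschitz _ _ _ Hu i x y) as Hl. apply Rabs_le_between in Hl. lra. }
apply Rabs_le. pose proof (H x y). pose proof (H y x) as H'. rewrite Rabs_minus_sym in H'. lra.
Qed.

Lemma envelope_pin (V : bool -> R -> R) (P : R) (phi : bool -> R -> R) (i : bool) (z : R) :
  admissible V P phi -> pin z -> envelope V P i z = 0.
Proof.
intros Hphi Hz. apply Rle_antisym.
- apply (envelope_le _ _ phi); auto. intros u Hu. rewrite (admissible_pin _ _ _ Hu); auto. lra.
- rewrite <- (admissible_pin _ _ _ Hphi i z Hz). apply envelope_ge, Hphi.
Qed.

Lemma admissible_shift (V : bool -> R -> R) (P : R) (u : bool -> R -> R) (n : Z) :
  (forall i x, V i (x + 1) = V i x) -> admissible V P u ->
  admissible V P (fun i x => u i (x + IZR n)).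
Proof.
intros HV Hu. split.
- intros i x y. replace (x - y) with (x + IZR n - (y + IZR n)) by ring. apply Hu.
- intros i z Hz. apply Hu, pin_shift, Hz.
- apply coupled_subsolution_shift; [|apply Hu]. intros i x. apply periodic_shift_IZR, HV.
Qed.

(** Admissible pairs need not be periodic, but their class is invariant under integer translations,
    and this makes the supremum periodic. *)
Lemma envelope_periodic (V : bool -> R -> R) (P : R) (phi : bool -> R -> R) (i : bool) (x : R) :
  (forall i x, V i (x + 1) = V i x) -> admissible V P phi ->
  envelope V P i (x + 1) = envelope V P i x.
Proof.
intros HV Hphi. apply Rle_antisym; apply (envelope_le _ _ phi); auto; intros u Hu.
- apply (envelope_ge _ _ _ i x (admissible_shift V P u 1 HV Hu)).
- pose proof (envelope_ge _ _ _ i (x + 1) (admissible_shift V P u (-1) HV Hu)) as H.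
  simpl in H. replace (x + 1 + -1) with x in H by ring. exact H.
Qed.

(** * Perron's method: the subsolution property *)

(** If the inequality failed at [x] by a margin [E], an admissible pair almost attaining the
    envelope at [x] would be touched by a perturbed test function at a nearby point, where its own
    inequality would fail too. *)
Lemma envelope_subsolution (V : bool -> R -> R) (P : R) (phi : bool -> R -> R) :
  (forall i x, continuous (V i) x) -> admissible V P phi ->
  coupled_subsolution V P 0 (envelope V P).
Proof.
intros HV Hadm i phi0 x Hphi Hloc. apply Rnot_lt_le. intros Hpos.
set (v := envelope V P) in *.
assert (Hv : forall k y, continuous (v k) y).
{ intros k. apply (lipschitz_continuous _ 6). intros. eapply envelope_lipschitz, Hadm. }
(* Adding a parabola makes the maximum strict, so that it survives the passage from the
   envelope to an admissible pair that almost attains it at [x]. *)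
pose (psi := fun z => 0 + phi0 z + 1 * (z - x) ^ 2 + 0).
assert (Hpsi : C1 psi) by (apply C1_add_parabola, Hphi).
assert (HD : forall y, Derive psi y = Derive phi0 y + 2 * 1 * (y - x)).
{ intros y. apply is_derive_unique, is_derive_add_parabola, Hphi. }
(* The value inserted is, up to the error [s] below, what touching at [y] forces on the almost
   maximal pair. *)
pose (G := fun y => weakly_coupled V P 0 v i y (v i x + (psi y - psi x)) (Derive psi y)).
set (E := weakly_coupled V P 0 v i x (v i x) (Derive phi0 x)) in *.
assert (HG : continuous (fun y => - G y) x).
{ apply (continuous_opp (V := R_NormedModule)), continuous_weakly_coupled; auto.
  - apply (continuous_plus (V := R_NormedModule)). apply continuous_const.
    apply (continuous_minus (V := R_NormedModule)). apply C1_continuous, Hpsi.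
    apply continuous_const.
  - apply Hpsi. }
assert (HG0 : - G x < - (E / 2)).
{ unfold G. rewrite HD. replace (v i x + (psi x - psi x)) with (v i x) by ring.
  replace (Derive phi0 x + 2 * 1 * (x - x)) with (Derive phi0 x) by ring. fold E. lra. }
destruct (locally_Rabs _ _ (filter_and _ _ (continuous_locally_lt _ _ _ HG HG0) Hloc))
  as [r' [Hr' Hr]].
pose (r := r' / 2). assert (Hr0 : 0 < r) by (unfold r; lra).
(* The bound [r ^ 2] makes the difference at [x] beat both endpoints; the bound [E / 2] preserves
   the sign of the operator. *)
pose (s := Rmin (r ^ 2) (E / 2)).
assert (Hs : 0 < s) by (apply Rmin_pos; [apply pow_lt|]; lra).
pose proof (Rmin_l (r ^ 2) (E / 2)) as Hs1. pose proof (Rmin_r (r ^ 2) (E / 2)) as Hs2. fold s in Hs1, Hs2.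
destruct (envelope_approx V P phi i x (v i x - s) Hadm) as [u [Hu Hux]].
{ fold v. lra. }
assert (Huv : forall k y, u k y <= v k y) by (intros; apply envelope_ge, Hu).
destruct (interior_max (fun y => u i y - psi y) x r) as [y [Hy [Hge Hmax]]]; auto.
- intros y. apply (continuous_minus (V := R_NormedModule)).
  apply (admissible_continuous _ _ _ Hu). apply C1_continuous, Hpsi.
- specialize (Huv i (x - r)). destruct (Hr (x - r)) as [_ H].
  { apply Rabs_def1; unfold r; lra. }
  unfold psi. replace (x - r - x) with (- r) by ring. nra.
- specialize (Huv i (x + r)). destruct (Hr (x + r)) as [_ H].
  { apply Rabs_def1; unfold r; lra. }
  unfold psi. replace (x + r - x) with r by ring. nra.
- pose proof (admissible_subsolution _ _ _ Hu i psi y Hpsi Hmax) as Hsub.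
  destruct (Hr y) as [HGy _]. { unfold r in Hy. lra. }
  (* The operator increases in its own component and decreases in the other one, so for [u] at [y]
     it is at least [G y - s], which is positive. *)
  specialize (Huv (negb i) y). simpl in Hge.
  unfold G, weakly_coupled in *. lra.
Qed.

(** * Perron's method: bumps and the supersolution property *)

Definition bump (v : bool -> R -> R) (b : R -> R) (i : bool) (x r : R) (k : bool) (y : R) : R :=
  if Bool.eqb k i then
    if Rlt_dec (Rabs (y - x)) r then Rmax (v k y) (b y) else v k y
  else v k y.

Lemma bump_ge (v : bool -> R -> R) (b : R -> R) (i : bool) (x r : R) (k : bool) (y : R) :
  v k y <= bump v b i x r k y.
Proof.
unfold bump. destruct (Bool.eqb k i), (Rlt_dec (Rabs (y - x)) r); try lra. apply Rmax_l.
Qed.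

Lemma bump_other (v : bool -> R -> R) (b : R -> R) (i : bool) (x r : R) (y : R) :
  bump v b i x r (negb i) y = v (negb i) y.
Proof. unfold bump. destruct i; reflexivity. Qed.

Lemma bump_near (v : bool -> R -> R) (b : R -> R) (i : bool) (x r : R) (y : R) :
  Rabs (y - x) < r -> b y <= bump v b i x r i y.
Proof.
intros Hy. unfold bump. rewrite Bool.eqb_reflx. destruct (Rlt_dec (Rabs (y - x)) r); [apply Rmax_r|lra].
Qed.

Lemma bump_cases (v : bool -> R -> R) (b : R -> R) (i : bool) (x r : R) (k : bool) (y : R) :
  bump v b i x r k y = v k y \/
  (k = i /\ Rabs (y - x) < r /\ bump v b i x r k y = b y).
Proof.
unfold bump. destruct (Bool.eqb k i) eqn:E; [|auto]. apply Bool.eqb_prop in E.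
destruct (Rlt_dec (Rabs (y - x)) r); [|auto]. apply Rmax_case; auto.
Qed.

(** The bumped function lies above [v] everywhere and above [b] in the ball, so only the piece
    attained at [y] has to be compared with the value at [z]. *)
Lemma bump_lipschitz (v : bool -> R -> R) (b : R -> R) (i : bool) (x r K : R) :
  0 < r -> 0 <= K ->
  (forall k y z, Rabs (v k y - v k z) <= K * Rabs (y - z)) ->
  (forall y z, Rabs (y - x) <= r -> Rabs (z - x) <= r -> Rabs (b y - b z) <= K * Rabs (y - z)) ->
  b (x - r) <= v i (x - r) -> b (x + r) <= v i (x + r) ->
  forall k y z, Rabs (bump v b i x r k y - bump v b i x r k z) <= K * Rabs (y - z).
Proof.
intros Hr HK Hv Hb Hl Hu k.
assert (H : forall y z, bump v b i x r k y - bump v b i x r k z <= K * Rabs (y - z)).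
{ intros y z. pose proof (bump_ge v b i x r k z) as Hz.
  destruct (bump_cases v b i x r k y) as [->|[-> [Hy ->]]].
  - pose proof (Rle_trans _ _ _ (Rle_abs _) (Hv k y z)). lra.
  - destruct (Rlt_dec (Rabs (z - x)) r) as [Hzx|Hzx].
    + pose proof (bump_near v b i x r z Hzx).
      assert (Hyz : Rabs (b y - b z) <= K * Rabs (y - z)) by (apply Hb; lra).
      pose proof (Rle_trans _ _ _ (Rle_abs _) Hyz). lra.
    + (* the segment from [y] to [z] leaves the ball through an endpoint [e], where [b <= v] *)
      assert (He : exists e, Rabs (e - x) <= r /\ b e <= v i e /\
                Rabs (y - e) + Rabs (e - z) = Rabs (y - z)).
      { apply Rabs_def2 in Hy. destruct (Rle_dec x z) as [Hxz|Hxz].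
        - rewrite Rabs_right in Hzx by lra. exists (x + r). split; [|split; auto].
          + apply Rabs_le. lra.
          + rewrite !Rabs_left1 by lra. ring.
        - rewrite Rabs_left in Hzx by lra. exists (x - r). split; [|split; auto].
          + apply Rabs_le. lra.
          + rewrite !Rabs_right by lra. ring. }
      destruct He as [e [Hex [Hbe Hsum]]].
      assert (Hye : Rabs (b y - b e) <= K * Rabs (y - e)) by (apply Hb; lra).
      pose proof (Rle_trans _ _ _ (Rle_abs _) Hye).
      pose proof (Rle_trans _ _ _ (Rle_abs _) (Hv i e z)).
      rewrite <- Hsum. lra. }
intros y z. apply Rabs_le. pose proof (H y z). pose proof (H z y) as H'.
rewrite Rabs_minus_sym in H'. lra.
Qed.

(** Where the old value is kept, the test function also touches [v], and raising the other component
    only lowers the operator. Where the value is that of [b], the test function has the slope of [b]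
    and the other component is unchanged. *)
Lemma bump_subsolution (V : bool -> R -> R) (P c : R) (v : bool -> R -> R) (b : R -> R)
    (i : bool) (x r : R) :
  coupled_subsolution V P c v -> (forall y, ex_derive b y) ->
  (forall y, Rabs (y - x) < r -> weakly_coupled V P c v i y (b y) (Derive b y) <= 0) ->
  coupled_subsolution V P c (bump v b i x r).
Proof.
intros Hv Hb Hbr k phi y Hphi Hloc.
pose proof (bump_ge v b i x r) as Hge.
destruct (bump_cases v b i x r k y) as [E|[-> [Hy E]]].
- assert (H : weakly_coupled V P c v k y (v k y) (Derive phi y) <= 0).
  { apply (Hv k phi y Hphi). eapply filter_imp; [|exact Hloc]. intros z Hz.
    specialize (Hge k z). rewrite E in Hz. lra. }
  specialize (Hge (negb k) y). rewrite E. unfold weakly_coupled in *. lra.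
- rewrite E. rewrite <- (Derive_eq_of_touching b phi y); auto; [|apply Hphi|].
  + specialize (Hbr y Hy). unfold weakly_coupled in *. rewrite bump_other. exact Hbr.
  + apply locally_Rabs in Hloc. destruct Hloc as [s [Hs H]].
    apply (Rabs_locally _ (Rmin s (r - Rabs (y - x)))).
    * apply Rmin_pos; lra.
    * intros z Hz. pose proof (Rmin_l s (r - Rabs (y - x))). pose proof (Rmin_r s (r - Rabs (y - x))).
      specialize (H z ltac:(lra)).
      assert (Rabs (z - x) < r).
      { replace (z - x) with (z - y + (y - x)) by ring. pose proof (Rabs_triang (z - y) (y - x)). lra. }
      pose proof (bump_near v b i x r z H2). lra.
Qed.

Lemma mean_value_lipschitz (f : R -> R) (a b K : R) :
  (forall x, ex_derive f x) -> (forall x, a <= x <= b -> Rabs (Derive f x) <= K) ->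
  forall x y, a <= x <= b -> a <= y <= b -> Rabs (f x - f y) <= K * Rabs (x - y).
Proof.
intros Hf HK x y Hx Hy.
destruct (MVT_gen f y x (Derive f)) as [c [Hc ->]].
- intros t _. apply Derive_correct, Hf.
- intros t _. apply continuity_pt_filterlim. apply (@ex_derive_continuous _ R_NormedModule), Hf.
- rewrite Rabs_mult. apply Rmult_le_compat_r. apply Rabs_pos. apply HK.
  destruct (Rle_dec y x) as [H|H].
  + rewrite Rmin_left, Rmax_right in Hc; lra.
  + rewrite Rmin_right, Rmax_left in Hc; lra.
Qed.

(** If the inequality fails at [x], then [x] is not a pin, and a slightly raised test function, bent
    down by a parabola, can be glued to the envelope near [x]. The result is admissible but exceeds
    the envelope at [x]. *)
Lemma envelope_supersolution (V : bool -> R -> R) (P : R) (phi : bool -> R -> R) :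
  Rabs P <= 1 -> (forall i x, continuous (V i) x) -> (forall i x, V i x <= 2) ->
  (forall i z, pin z -> V i z = 0) -> admissible V P phi ->
  coupled_supersolution V P 0 (envelope V P).
Proof.
intros HP HV HV2 Hpin Hadm i phi0 x Hphi Hloc. apply Rnot_lt_le. intros Hneg.
set (v := envelope V P) in *.
assert (Hl : forall k y z, Rabs (v k y - v k z) <= 6 * Rabs (y - z)).
{ intros. eapply envelope_lipschitz, Hadm. }
assert (Hv : forall k y, continuous (v k) y).
{ intros k. apply (lipschitz_continuous _ 6), Hl. }
assert (Hsub : coupled_subsolution V P 0 v) by (apply (envelope_subsolution _ _ phi); auto).
assert (Hvadm : admissible V P v).
{ split; auto. intros k z. apply (envelope_pin _ _ phi); auto. }
assert (Hxpin : ~ pin x).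
{ intros Hx. unfold weakly_coupled, potential_hamiltonian in Hneg. rewrite pow2_abs in Hneg.
  rewrite !(admissible_pin _ _ _ Hvadm), Hpin in Hneg by exact Hx.
  pose proof (pow2_ge_0 (P + Derive phi0 x)). lra. }
pose (b := fun d z => v i x - phi0 x + phi0 z + (-1) * (z - x) ^ 2 + d).
assert (Hb : forall d, C1 (b d)) by (intros; apply C1_add_parabola, Hphi).
assert (HD : forall d y, Derive (b d) y = Derive phi0 y + 2 * (-1) * (y - x)).
{ intros d y. apply is_derive_unique, is_derive_add_parabola, Hphi. }
set (E := weakly_coupled V P 0 v i x (v i x) (Derive phi0 x)) in *.
assert (HG : locally x (fun y => weakly_coupled V P 0 v i y (b 0 y) (Derive (b 0) y) < E / 2)).
{ apply continuous_locally_lt.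
  - apply continuous_weakly_coupled; auto. apply C1_continuous, Hb. apply Hb.
  - rewrite HD. unfold b.
    replace (v i x - phi0 x + phi0 x + -1 * (x - x) ^ 2 + 0) with (v i x) by ring.
    replace (Derive phi0 x + 2 * -1 * (x - x)) with (Derive phi0 x) by ring. fold E. lra. }
(* The failed inequality itself bounds the slope [p] at [x]: [(P + p) ^ 2 < 2 + 12], with
   [Rabs P <= 1]. *)
assert (HK : locally x (fun y => Rabs (Derive (b 0) y) < 6)).
{ apply continuous_locally_lt.
  - apply (continuous_comp (Derive (b 0)) Rabs). apply Hb. apply continuous_Rabs.
  - rewrite HD. replace (Derive phi0 x + 2 * -1 * (x - x)) with (Derive phi0 x) by ring.
    unfold E, weakly_coupled, potential_hamiltonian in Hneg. rewrite pow2_abs in Hneg.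
    specialize (HV2 i x).
    pose proof (admissible_bound _ _ _ i x Hvadm) as B1. apply Rabs_le_between in B1.
    pose proof (admissible_bound _ _ _ (negb i) x Hvadm) as B2. apply Rabs_le_between in B2.
    apply Rabs_le_between in HP. apply Rabs_def1; nra. }
destruct (locally_Rabs _ _ (filter_and _ _ (filter_and _ _ HG HK)
  (filter_and _ _ (locally_not_pin x Hxpin) Hloc))) as [r' [Hr' Hnear]].
pose (r := r' / 2). assert (Hr : 0 < r) by (unfold r; lra).
(* The bound [r ^ 2] keeps the bump below the envelope at the edges; the bound [- (E / 2)] uses the
   half of the margin left by [HG]. *)
pose (d := Rmin (r ^ 2) (- (E / 2))).
assert (Hd : 0 < d) by (apply Rmin_pos; [apply pow_lt|]; lra).
pose proof (Rmin_l (r ^ 2) (- (E / 2))) as Hd1. pose proof (Rmin_r (r ^ 2) (- (E / 2))) as Hd2.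
fold d in Hd1, Hd2.
assert (Hedge : forall y, (y - x) ^ 2 = r ^ 2 -> Rabs (y - x) < r' -> b d y <= v i y).
{ intros y Hy Hyr. destruct (Hnear y Hyr) as [_ [_ H]]. unfold b. lra. }
assert (Hw : admissible V P (bump v (b d) i x r)).
{ split.
  - apply bump_lipschitz; auto; try lra.
    + intros y z Hy Hz. apply Rabs_le_between' in Hy. apply Rabs_le_between' in Hz.
      apply (mean_value_lipschitz _ (x - r) (x + r)); auto. intros t; apply Hb.
      intros t Ht. rewrite HD, <- (HD 0). left. apply Hnear.
      apply Rabs_def1; unfold r in Ht; lra.
    + apply Hedge. ring. apply Rabs_def1; unfold r; lra.
    + apply Hedge. ring. apply Rabs_def1; unfold r; lra.
  - intros k z Hz. destruct (bump_cases v (b d) i x r k z) as [->|[_ [Hzx _]]].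
    + apply Hvadm, Hz.
    + destruct (Hnear z) as [_ [H _]]. unfold r in Hzx; lra. contradiction.
  - apply bump_subsolution; auto. intros y; apply Hb.
    intros y Hy. destruct (Hnear y) as [[H _] _]. unfold r in Hy; lra.
    rewrite HD, <- (HD 0).
    unfold b at 1. unfold b at 1 in H. unfold weakly_coupled in *. lra. }
(* Maximality caps the bumped pair at [v i x], whereas the bump has the value [v i x + d] there. *)
pose proof (envelope_ge _ _ _ i x Hw) as Hle. fold v in Hle.
pose proof (bump_near v (b d) i x r x) as Hb0. unfold Rminus in Hb0 at 1.
rewrite Rplus_opp_r, Rabs_R0 in Hb0. specialize (Hb0 Hr).
unfold b at 1 in Hb0. replace (v i x - phi0 x + phi0 x + -1 * (x - x) ^ 2 + d) with (v i x + d) in Hb0 by ring.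
lra.
Qed.

Lemma exists_cell_problem_solution (V : bool -> R -> R) (P : R) (phi : bool -> R -> R) :
  Rabs P <= 1 -> (forall i, continuous_on_torus (V i)) -> (forall i x, V i x <= 2) ->
  (forall i z, pin z -> V i z = 0) -> admissible V P phi ->
  exists v1 v2, cell_problem_solution
    (potential_hamiltonian (V true)) (potential_hamiltonian (V false)) P 0 v1 v2.
Proof.
intros HP HV HV2 Hpin Hadm.
assert (HVc : forall i x, continuous (V i) x) by (intros; apply HV).
assert (Hsub : coupled_subsolution V P 0 (envelope V P)) by (apply (envelope_subsolution _ _ phi); auto).
assert (Hsup : coupled_supersolution V P 0 (envelope V P)) by (apply (envelope_supersolution _ _ phi); auto).
assert (Ht : forall i, continuous_on_torus (envelope V P i)).
{ intros i. split.
  - apply (lipschitz_continuous _ 6). intros. apply (envelope_lipschitz _ _ phi); auto.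
  - intros x. apply (envelope_periodic _ _ phi); auto. intros; apply HV. }
exists (envelope V P true), (envelope V P false).
split; [apply Ht|split; [apply Ht|split; split]].
- apply (Hsub true).
- apply (Hsup true).
- apply (Hsub false).
- apply (Hsup false).
Qed.

(** * The periodic profile *)

(** For all signs of [t] and [t + h] the first-order remainder is at most [h ^ 2]. Squaring thus
    removes the corners of the profile. *)
Lemma is_derive_square_pos_part (t : R) : is_derive (fun t => Rmax 0 t ^ 2) t (2 * Rmax 0 t).
Proof.
apply is_derive_Reals. intros e He. exists (mkposreal e He). intros h Hh Hhe. simpl in Hhe.
apply Rle_lt_trans with (2 := Hhe).
assert (H : Rabs (Rmax 0 (t + h) ^ 2 - Rmax 0 t ^ 2 - h * (2 * Rmax 0 t)) <= Rabs h * Rabs h).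
{ rewrite <- Rabs_mult, (Rabs_right (h * h)) by nra. apply Rabs_le.
  apply (Rmax_case_strong 0 (t + h)); apply (Rmax_case_strong 0 t); intros; nra. }
replace ((Rmax 0 (t + h) ^ 2 - Rmax 0 t ^ 2) / h - 2 * Rmax 0 t)
  with ((Rmax 0 (t + h) ^ 2 - Rmax 0 t ^ 2 - h * (2 * Rmax 0 t)) / h) by (field; exact Hh).
unfold Rdiv at 1. rewrite Rabs_mult, Rabs_inv. apply Rabs_pos_lt in Hh.
apply Rmult_le_reg_r with (Rabs h); auto. rewrite Rmult_assoc, Rinv_l, Rmult_1_r by lra. exact H.
Qed.

(** This is the [q] of the overview. In one period it vanishes exactly on [[1/3, 2/3]], which
    contains [[6/16, 10/16]], and it is at least 1/2 where the cosine is nonnegative, that is,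
    outside [(4/16, 12/16)]. *)
Definition profile (x : R) : R := Rmax 0 (/ 2 + cos (2 * PI * x)).

Lemma profile_periodic (x : R) : profile (x + 1) = profile x.
Proof.
unfold profile. replace (2 * PI * (x + 1)) with (2 * PI * x + 2 * PI) by ring.
rewrite cos_plus, cos_2PI, sin_2PI. do 2 f_equal. ring.
Qed.

Lemma profile_bound (x : R) : 0 <= profile x <= 3 / 2.
Proof.
unfold profile. pose proof (COS_bound (2 * PI * x)).
split. apply Rmax_l. apply Rmax_lub; lra.
Qed.

Lemma profile_continuous (x : R) : continuous profile x.
Proof.
unfold profile. apply continuous_ext with (fun x => (/ 2 + cos (2 * PI * x) + Rabs (/ 2 + cos (2 * PI * x))) / 2).
- intros y. apply (Rmax_case_strong 0 (/ 2 + cos (2 * PI * y))); intros H.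
  + rewrite Rabs_left1 by lra. simpl. lra.
  + rewrite Rabs_right by lra. simpl. lra.
- assert (Hc : continuous (fun x => / 2 + cos (2 * PI * x)) x).
  { apply (@ex_derive_continuous _ R_NormedModule). auto_derive. trivial. }
  apply (continuous_mult (K := R_AbsRing)); [|apply continuous_const].
  apply (continuous_plus (V := R_NormedModule)); [exact Hc|].
  apply (continuous_comp _ Rabs); [exact Hc|apply continuous_Rabs].
Qed.

Lemma is_derive_profile_sq (x : R) :
  is_derive (fun y => profile y ^ 2) x (- (4 * PI) * profile x * sin (2 * PI * x)).
Proof.
replace (- (4 * PI) * profile x * sin (2 * PI * x))
  with (scal (- (2 * PI) * sin (2 * PI * x)) (2 * profile x)).
2: { unfold scal. simpl. unfold mult. simpl. ring. }
apply (is_derive_comp (fun t => Rmax 0 t ^ 2) (fun y => / 2 + cos (2 * PI * y))).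
- apply is_derive_square_pos_part.
- auto_derive. trivial. ring.
Qed.

Lemma profile_reflect (x : R) : profile (1 - x) = profile x.
Proof.
unfold profile. replace (2 * PI * (1 - x)) with (- (2 * PI * x) + 2 * PI) by ring.
rewrite cos_plus, cos_2PI, sin_2PI, cos_neg. do 2 f_equal. ring.
Qed.

Lemma profile_ge (x : R) : 0 <= x <= 1 -> ~ (4 / 16 < x < 12 / 16) -> / 2 <= profile x.
Proof.
assert (H : forall x, 0 <= x <= 4 / 16 -> / 2 <= profile x).
{ clear x. intros x Hx. apply Rle_trans with (2 := Rmax_r _ _). pose proof PI_RGT_0.
  assert (0 <= cos (2 * PI * x)); [|lra]. apply cos_ge_0; nra. }
intros Hx Hout. destruct (Rle_dec x (4 / 16)).
- apply H. lra.
- rewrite <- profile_reflect. apply H. lra.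
Qed.

(** The cosine decreases on the half period, [6 / 16] exceeds 1/3, and the cosine of [2 * (PI / 3)]
    is -1/2; reflection gives the other half. *)
Lemma profile_eq_0 (x : R) : 6 / 16 <= x <= 10 / 16 -> profile x = 0.
Proof.
assert (H : forall x, 6 / 16 <= x <= / 2 -> profile x = 0).
{ clear x. intros x Hx. apply Rmax_left. pose proof PI_RGT_0.
  assert (cos (2 * PI * x) <= cos (2 * (PI / 3))).
  { apply cos_decr_1; nra. }
  rewrite cos_2PI3 in *. lra. }
intros Hx. destruct (Rle_dec x (/ 2)).
- apply H. lra.
- rewrite <- profile_reflect. apply H. lra.
Qed.

(** The base point 1/2 makes the barrier vanish on [pin]. *)
Definition profile_primitive (x : R) : R := RInt profile (/ 2) x.

Lemma is_derive_profile_primitive (x : R) : is_derive profile_primitive x (profile x).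
Proof.
apply (is_derive_RInt (V := R_NormedModule) profile profile_primitive (/ 2) x).
- apply filter_forall. intros y. apply (RInt_correct (V := R_CompleteNormedModule)).
  apply (ex_RInt_continuous (V := R_CompleteNormedModule)). intros; apply profile_continuous.
- apply profile_continuous.
Qed.

Definition profile_mean : R := profile_primitive 1 - profile_primitive 0.

(** By periodicity of the profile the increment over a period has derivative 0, so it equals its
    value at 0. *)
Lemma profile_primitive_shift (x : R) :
  profile_primitive (x + 1) = profile_primitive x + profile_mean.
Proof.
pose (f := fun x => profile_primitive (x + 1) - profile_primitive x).
assert (Hd : forall y, is_derive f y 0).
{ intros y. replace 0 with (profile (y + 1) - profile y) by (rewrite profile_periodic; ring).
  apply (is_derive_minus (fun y => profile_primitive (y + 1)) profile_primitive);
    [|apply is_derive_profile_primitive].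
  replace (profile (y + 1)) with (scal 1 (profile (y + 1)))
    by (unfold scal; simpl; unfold mult; simpl; ring).
  apply (is_derive_comp profile_primitive (fun y => y + 1)).
  apply is_derive_profile_primitive. auto_derive. trivial. ring. }
assert (E : Rabs (f x - f 0) <= 0 * Rabs (x - 0)).
{ apply (mean_value_lipschitz f (Rmin x 0) (Rmax x 0)).
  - intros y. exists 0. apply Hd.
  - intros y _. rewrite (is_derive_unique _ _ _ (Hd y)), Rabs_R0. lra.
  - split. apply Rmin_l. apply Rmax_l.
  - split. apply Rmin_r. apply Rmax_r. }
rewrite Rmult_0_l in E. apply Rabs_le_between in E. unfold f in E. rewrite Rplus_0_l in E.
unfold profile_mean. lra.
Qed.

(** The profile is at least 1/2 on [[0, 1/4]] and nonnegative on the rest of the period. *)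
Lemma profile_mean_pos : 0 < profile_mean.
Proof.
assert (H : forall x y, exists c, Rmin x y <= c <= Rmax x y /\
  profile_primitive y - profile_primitive x = profile c * (y - x)).
{ intros x y. apply MVT_gen.
  - intros. apply is_derive_profile_primitive.
  - intros t _. apply continuity_pt_filterlim. apply (@ex_derive_continuous _ R_NormedModule).
    eexists. apply is_derive_profile_primitive. }
destruct (H 0 (/ 4)) as [c [Hc E]]. destruct (H (/ 4) 1) as [c' [_ E']].
rewrite Rmin_left, Rmax_right in Hc by lra.
assert (/ 2 <= profile c) by (apply profile_ge; lra).
pose proof (profile_bound c'). unfold profile_mean. nra.
Qed.

(** * The explicit subsolution for small P *)

(** The linear term cancels [P] in [P + p] and leaves a multiple of the profile; dividing by
    [profile_mean] makes the sum periodic. The index [true] belongs to the first potential. *)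
Definition barrier (P : R) (i : bool) (x : R) : R :=
  P / profile_mean * profile_primitive x - P * (x - / 2)
  + (if i then - / 1000 else 0) * profile x ^ 2.

Lemma is_derive_barrier (P : R) (i : bool) (x : R) :
  is_derive (barrier P i) x
    (P / profile_mean * profile x - P
     + (if i then - / 1000 else 0) * (- (4 * PI) * profile x * sin (2 * PI * x))).
Proof.
unfold barrier.
apply (is_derive_plus (fun x => P / profile_mean * profile_primitive x - P * (x - / 2))
         (fun x => (if i then - / 1000 else 0) * profile x ^ 2)).
- apply (is_derive_minus (fun x => P / profile_mean * profile_primitive x)
           (fun x => P * (x - / 2))).
  + apply is_derive_scal, is_derive_profile_primitive.
  + auto_derive. trivial. ring.
- apply (is_derive_scal (fun x => profile x ^ 2)), is_derive_profile_sq.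
Qed.

Lemma barrier_C1 (P : R) (i : bool) : C1 (barrier P i).
Proof.
apply is_derive_C1 with (1 := is_derive_barrier P i). intros x.
apply (continuous_plus (V := R_NormedModule)).
- apply (continuous_minus (V := R_NormedModule)); [|apply continuous_const].
  apply (continuous_mult (K := R_AbsRing)). apply continuous_const. apply profile_continuous.
- apply (continuous_mult (K := R_AbsRing)). apply continuous_const.
  apply (continuous_mult (K := R_AbsRing)).
  + apply (continuous_mult (K := R_AbsRing)). apply continuous_const. apply profile_continuous.
  + apply (@ex_derive_continuous _ R_NormedModule). auto_derive. trivial.
Qed.

Lemma barrier_periodic (P : R) (i : bool) (x : R) : barrier P i (x + 1) = barrier P i x.
Proof.
unfold barrier. rewrite profile_primitive_shift, profile_periodic.
pose proof profile_mean_pos. field. lra.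
Qed.

Lemma barrier_pin (P : R) (i : bool) (z : R) : pin z -> barrier P i z = 0.
Proof.
intros [k ->]. rewrite Rplus_comm, periodic_shift_IZR by apply barrier_periodic.
unfold barrier, profile_primitive. rewrite profile_eq_0 by lra.
rewrite RInt_point. unfold zero. simpl. ring.
Qed.

(** Write [q] for the profile. In the first equation the coupling contributes [- q ^ 2 / 1000]; half
    of it absorbs the squared gradient and half absorbs [- V true x]. In the second it contributes
    [+ q ^ 2 / 1000], which is 0 or dominated by the value 2 of the potential. *)
Lemma barrier_subsolution (V : bool -> R -> R) (P : R) :
  (forall x, - / 2000 * profile x ^ 2 <= V true x) -> (forall x, 0 <= V false x) ->
  (forall x, profile x = 0 \/ V false x = 2) ->
  Rabs P <= profile_mean / 1000 ->
  forall i x, weakly_coupled V P 0 (barrier P) i x (barrier P i x) (Derive (barrier P i) x) <= 0.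
Proof.
intros H1 H2 H2' HP i x. pose proof profile_mean_pos as HM.
rewrite (is_derive_unique _ _ _ (is_derive_barrier P i x)).
unfold weakly_coupled, potential_hamiltonian, barrier. rewrite pow2_abs.
assert (Hs : - / 1000 <= P / profile_mean <= / 1000).
{ apply Rabs_le_between in HP. split; apply Rmult_le_reg_r with profile_mean; auto;
    unfold Rdiv; rewrite (Rmult_assoc P), Rinv_l; lra. }
set (s := P / profile_mean) in *. specialize (H1 x). specialize (H2 x). specialize (H2' x).
pose proof (profile_bound x) as Hq. set (q := profile x) in *.
destruct i; simpl negb; cbv iota.
- pose proof (SIN_bound (2 * PI * x)) as Hsin. pose proof PI_RGT_0. pose proof PI_4.
  set (t := PI * sin (2 * PI * x)).
  assert (Ht : -4 <= t <= 4) by (unfold t; split; nra).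
  replace (P + (s * q - P + - / 1000 * (- (4 * PI) * q * sin (2 * PI * x))))
    with (q * (s + 4 / 1000 * t)) by (unfold t; field).
  (* Here [s + 4 / 1000 * t] is at most 17/1000 in absolute value. *)
  assert (Hst : (s + 4 / 1000 * t) ^ 2 <= / 2000) by nra.
  rewrite Rpow_mult_distr. pose proof (pow2_ge_0 q). nra.
- replace (P + (s * q - P + 0 * (- (4 * PI) * q * sin (2 * PI * x)))) with (s * q) by ring.
  destruct H2' as [Hq0|HV2].
  + rewrite Hq0. lra.
  + rewrite HV2, Rpow_mult_distr.
    assert (s ^ 2 <= / 1000) by nra. assert (q ^ 2 <= 9 / 4) by nra. pose proof (pow2_ge_0 q). nra.
Qed.

(** The subsolution inequality gives the Lipschitz bound: the components differ by at most 1, so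
    [(P + p) ^ 2 <= 2 + 1]. *)
Lemma barrier_admissible (V : bool -> R -> R) (P : R) :
  Rabs P <= 1 -> (forall i x, V i x <= 2) ->
  (forall i x, weakly_coupled V P 0 (barrier P) i x (barrier P i x) (Derive (barrier P i) x) <= 0) ->
  admissible V P (barrier P).
Proof.
intros HP HV H. split.
- intros i x y. apply (mean_value_lipschitz _ (Rmin x y) (Rmax x y)).
  + intros z. apply barrier_C1.
  + intros z _. specialize (H i z). specialize (HV i z).
    unfold weakly_coupled, potential_hamiltonian in H. rewrite pow2_abs in H.
    assert (Hd : - 1 <= barrier P i z - barrier P (negb i) z).
    { pose proof (profile_bound z). unfold barrier. destruct i; simpl negb; cbv iota; nra. }
    apply Rabs_le_between in HP. apply Rabs_le. nra.
  + split. apply Rmin_l. apply Rmax_l.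
  + split. apply Rmin_r. apply Rmax_r.
- intros i z. apply barrier_pin.
- apply classical_subsolution; auto. intros; apply barrier_C1.
Qed.

(** * Choice of the thresholds, existence and uniqueness of the constant 0 *)

Theorem theorem4p14 :
  exists epsbar : R, 0 < epsbar /\
  forall eps0 : R, 0 < eps0 < epsbar ->
  forall V1 V2 : R -> R,
    continuous_on_torus V1 -> continuous_on_torus V2 ->
    (forall xi : R, 0 <= xi <= 1 -> (V1 xi = 0 <-> 4 / 16 <= xi <= 12 / 16)) ->
    (forall xi : R, 0 <= xi <= 1 -> (V1 xi = - eps0 <-> ~ (3 / 16 < xi < 13 / 16))) ->
    (forall xi : R, - eps0 <= V1 xi <= 0) ->
    (forall xi : R, 0 <= xi <= 1 -> (V2 xi = 0 <-> 7 / 16 <= xi <= 9 / 16)) ->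
    (forall xi : R, 0 <= xi <= 1 -> (V2 xi = 2 <-> ~ (6 / 16 < xi < 10 / 16))) ->
    (forall xi : R, 0 <= V2 xi <= 2) ->
    exists gamma : R, 0 < gamma /\
      forall P : R, Rabs P <= gamma ->
        is_effective_hamiltonian
          (potential_hamiltonian V1) (potential_hamiltonian V2) P 0.
Proof.
(* Where the first potential may be negative the profile [q] is at least 1/2, so [q ^ 2 / 2000] is
   at least 1/8000. *)
exists (/ 8000). split. lra.
intros eps0 Heps V1 V2 HV1 HV2 Z1 _ B1 Z2 T2 B2.
pose proof profile_mean_pos as HM.
(* The bound 1 serves the Lipschitz estimates, the other one the barrier. *)
exists (Rmin 1 (profile_mean / 1000)). split. apply Rmin_pos; lra.
intros P HP.
assert (HP1 : Rabs P <= 1) by (apply Rle_trans with (1 := HP), Rmin_l).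
assert (HPM : Rabs P <= profile_mean / 1000) by (apply Rle_trans with (1 := HP), Rmin_r).
pose (V := fun i : bool => if i then V1 else V2).
assert (HV : forall i, continuous_on_torus (V i)) by (intros []; assumption).
assert (Hle : forall i x, V i x <= 2) by (intros [] x; simpl; [specialize (B1 x)|specialize (B2 x)]; lra).
assert (Hpin : forall i z, pin z -> V i z = 0).
{ intros i z [k ->]. rewrite Rplus_comm, periodic_shift_IZR by apply HV.
  destruct i; simpl; [apply Z1|apply Z2]; lra. }
assert (Hbar : forall i x,
  weakly_coupled V P 0 (barrier P) i x (barrier P i x) (Derive (barrier P i) x) <= 0).
{ apply barrier_subsolution; auto.
  - intros x. destruct (exists_frac x) as [n Hn]. simpl.
    rewrite <- (periodic_shift_IZR V1 n x), <- (periodic_shift_IZR profile n x)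
      by (apply HV1 || apply profile_periodic).
    pose proof (pow2_ge_0 (profile (x + IZR n))).
    destruct (Rle_dec (4 / 16) (x + IZR n)), (Rle_dec (x + IZR n) (12 / 16));
      [rewrite (proj2 (Z1 _ Hn)) by lra; lra| | |];
      assert (/ 2 <= profile (x + IZR n)) by (apply profile_ge; lra);
      specialize (B1 (x + IZR n)); nra.
  - intros x. apply B2.
  - intros x. destruct (exists_frac x) as [n Hn]. simpl.
    rewrite <- (periodic_shift_IZR V2 n x), <- (periodic_shift_IZR profile n x)
      by (apply HV2 || apply profile_periodic).
    destruct (Rlt_dec (6 / 16) (x + IZR n)), (Rlt_dec (x + IZR n) (10 / 16));
      [left; apply profile_eq_0; lra| | |]; right; apply T2; lra. }
split.
- apply (exists_cell_problem_solution V P (barrier P)); auto.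
  apply barrier_admissible; auto.
- intros c [v1 [v2 [T1' [T2' [[S1 S1'] [S2 S2']]]]]].
  pose (v := fun i : bool => if i then v1 else v2).
  assert (Hv : forall i, continuous_on_torus (v i)) by (intros []; assumption).
  assert (Hsub : coupled_subsolution V P c v) by (intros []; assumption).
  assert (Hsup : coupled_supersolution V P c v) by (intros []; assumption).
  assert (c <= 0).
  { apply (constant_le_of_classical_subsolution V P 0 c (barrier P) v); auto.
    intros; apply barrier_C1. intros; apply barrier_periodic. }
  assert (HVc : forall i x, continuous (V i) x) by (intros; apply HV).
  assert (Hvc : forall i x, continuous (v i) x) by (intros; apply Hv).
  (* At 1/2 both potentials vanish, so adding the two gaps gives [0 <= 2 * c]. *)
  pose proof (subsolution_gap V P c v true (/ 2) (HVc true) Hvc Hsub) as G1.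
  pose proof (subsolution_gap V P c v false (/ 2) (HVc false) Hvc Hsub) as G2.
  assert (pin (/ 2)) by (exists 0%Z; ring).
  rewrite Hpin in G1, G2 by assumption. simpl in G1, G2. lra.
Qed.
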